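(* For any prime $p$, there is a $G$-coloring of $K_{p^2-p}$, where $G=(\mathbb Z/p^2\mathbb Z)^*$ is the group of units modulo $p^2$.
   Context: $[n]=\{1,\dots,n\}$. $K_n$ is the set of positive integers all of whose prime factors are less than or equal to $n$. An $n$-satisfactory coloring of $K_n$ is a map $c:K_n\to[n]$ with $c(i)=i$ for all $i\in[n]$ and such that for every $a\in K_n$ the colors $c(a),c(2a),\dots,c(na)$ are all different. For a group $(G,\cdot)$ of order $n$, an $n$-satisfactory coloring $c$ of $K_n$ is a $G$-coloring if there is a bijection $\varphi:[n]\to G$ such that $h=\varphi\circ c$ satisfies $h(ab)=h(a)\cdot h(b)$ for all $a,b\in K_n$. *)

(* Defs.v *)
From mathcomp Require Import all_boot all_order all_algebra all_fingroup.

Set Implicit Arguments.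
Unset Strict Implicit.
Unset Printing Implicit Defensive.

Local Open Scope nat_scope.

Definition interval (n : nat) : {pred nat} := [pred i | 0 < i <= n].

(* [pi.-nat a] includes [0 < a]. *)
Definition K (n : nat) : {pred nat} :=
  [pred a | [pred q | q <= n].-nat a].

(* A map from [K n] to [interval n] is given by a function on [nat], of which
   only the values on [K n] matter. *)
Definition satisfactory (n : nat) (c : nat -> nat) : Prop :=
  [/\ {in K n, forall a, c a \in interval n},
      {in interval n, forall i, c i = i}
    & {in K n, forall a, {in interval n &, injective (fun i => c (i * a))}}].

Definition bij_interval (gT : finGroupType) (G : {group gT}) (n : nat)
    (phi : nat -> gT) : Prop :=
  [/\ {in interval n, forall i, phi i \in G},
      {in interval n &, injective phi}
    & {in G, forall g, exists2 i, i \in interval n & phi i = g}].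

(* The bijection [phi] forces [#|G| = n]. *)
Definition G_coloring (gT : finGroupType) (G : {group gT}) (n : nat)
    (c : nat -> nat) : Prop :=
  satisfactory n c /\
  exists2 phi : nat -> gT, bij_interval G n phi
    & {in K n &, forall a b : nat,
         phi (c (a * b)) = (phi (c a) * phi (c b))%g}.

(* Main.v *)
Require Import Defs.
From mathcomp Require Import all_boot all_order all_algebra all_fingroup.

(** A [G]-coloring of [K n] is the same thing as a multiplicative map
[h : K n -> G] that is bijective on [1 .. n]: the color of [a] is the unique
[i <= n] with [h i = h a], and two colors [c (i * a) = c (j * a)] agree only if
[h i * h a = h j * h a], so only if [i = j]. This is [G_coloring_of_morph].

A multiplicative map is freely determined by its values on primes. For
[G = (Z / p^2)^*] every prime [q != p] is sent to its own class, which leaves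
only the image of [p] to be chosen. The integers prime to [p] in
[1 .. p^2 - p] are already sent to distinct units, and the units that they miss
are [-1], ..., [-(p - 1)]. The remaining integers are [p], [2 p], ...,
[(p - 1) p], so that sending [p] to [-1] fills exactly the gap. Since the group
has [p^2 - p] elements, it is enough to check injectivity, which is
[signed_p'part_inj]. *)

Set Implicit Arguments.
Unset Strict Implicit.
Unset Printing Implicit Defensive.

Import GRing.Theory.
(* The name [interval] also denotes the type of intervals of an order. *)
Import Defs.
Local Open Scope nat_scope.

Lemma interval_K n : {subset interval n <= K n}.
Proof.
move=> i /andP[i_gt0 le_in]; apply/pnatP => // q _ q_dvd_i.
exact: leq_trans (dvdn_leq i_gt0 q_dvd_i) le_in.
Qed.

Lemma mulK_closed n a b : a \in K n -> b \in K n -> a * b \in K n.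
Proof. by move=> Ka Kb; rewrite inE pnatM; apply/andP. Qed.

Lemma bij_interval_card (gT : finGroupType) (G : {group gT}) n (h : nat -> gT) :
  #|G| = n -> {in interval n, forall i, h i \in G} ->
  {in interval n &, injective h} -> bij_interval G n h.
Proof.
move=> cardG hG h_inj; split=> // g Gg.
pose f (i : 'I_n) := h i.+1.
have f_inj : injective f.
  move=> i j /h_inj; rewrite !inE /= !ltn_ord => /(_ isT isT) [].
  exact: val_inj.
have imf : f @: 'I_n = G.
  apply/eqP; rewrite eqEcard cardG card_imset // card_ord leqnn andbT.
  by apply/subsetP => _ /imsetP[i _ ->]; apply: hG; rewrite inE /= ltn_ord.
have /imsetP[i _ ->] : g \in f @: 'I_n by rewrite imf.
by exists i.+1; rewrite // inE /= ltn_ord.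
Qed.

(** The bijection of the coloring is [h] itself: [h (c a) = h a], so the two
requirements on [c] are cancellation and multiplicativity of [h]. *)
Lemma G_coloring_of_morph (gT : finGroupType) (G : {group gT}) n
    (h : nat -> gT) :
  {in K n, forall a, h a \in G} ->
  {in K n &, forall a b, h (a * b) = (h a * h b)%g} ->
  bij_interval G n h -> exists c, G_coloring G n c.
Proof.
move=> hG hM h_bij; have [_ h_inj h_surj] := h_bij.
pose s := iota 1 n; pose c a := nth 0 s (index (h a) (map h s)).
have mem_s i : (i \in s) = (i \in interval n) by rewrite mem_iota.
have img a : a \in K n -> h a \in map h s.
  move=> Ka; have [i ni <-] := h_surj _ (hG a Ka).
  by rewrite map_f // mem_s.
have c_int a : a \in K n -> c a \in interval n.
  by move=> Ka; rewrite -mem_s mem_nth // -(size_map h) index_mem img.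
have hc a : a \in K n -> h (c a) = h a.
  move=> Ka; rewrite -(nth_map _ (h 0)) ?nth_index ?img //.
  by rewrite -(size_map h) index_mem img.
exists c; split; last first.
  by exists h => // a b Ka Kb; rewrite !hc ?mulK_closed // hM.
split=> // [i ni|a Ka i j ni nj eq_c].
  by apply: h_inj; rewrite ?hc ?c_int ?interval_K.
have [Ki Kj] := (interval_K ni, interval_K nj).
apply: h_inj => //; apply: (mulIg (h a)).
by rewrite -!hM // -[LHS]hc ?mulK_closed // eq_c hc ?mulK_closed.
Qed.

(** The completely multiplicative map sending [p] to [-1] and each other prime
to its residue class. *)
Definition signed_p'part (p a : nat) : 'Z_(p ^ 2) :=
  ((-1) ^+ logn p a * (a`_p^')%:R)%R.

Section PrimeSquare.

Variable p : nat.
Hypothesis p_prime : prime p.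

Let p_gt1 : 1 < p := prime_gt1 p_prime.

Let p2_gt1 : 1 < p ^ 2.
Proof. by rewrite -(exp1n 2) ltn_sqr. Qed.

Let le_p_p2 : p <= p ^ 2.
Proof. by rewrite -{1}[p]expn1 leq_exp2l. Qed.

Lemma signed_p'partM a b : 0 < a -> 0 < b ->
  signed_p'part p (a * b) = (signed_p'part p a * signed_p'part p b)%R.
Proof.
move=> a_gt0 b_gt0.
by rewrite /signed_p'part lognM // partnM // natrM exprD mulrACA.
Qed.

Lemma signed_p'part_unit a : signed_p'part p a \is a GRing.unit.
Proof.
rewrite unitrM unitrX ?unitrN1 //= unitZpE // coprimeXl //.
by rewrite (@pnat_coprime p) ?pnat_id ?part_pnat.
Qed.

Lemma signed_p'part_coprime a : ~~ (p %| a) -> signed_p'part p a = (a%:R)%R.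
Proof.
move=> ndvd; have a_gt0 : 0 < a by case: a ndvd; rewrite ?dvdn0.
rewrite /signed_p'part lognE p_prime a_gt0 (negPf ndvd) mul1r.
by rewrite part_pnat_id // p'natE.
Qed.

Lemma signed_p'part_mulp k : ~~ (p %| k) ->
  signed_p'part p (k * p) = (- (k%:R))%R.
Proof.
move=> ndvd; have k_gt0 : 0 < k by case: k ndvd; rewrite ?dvdn0.
rewrite signed_p'partM ?(prime_gt0 p_prime) // signed_p'part_coprime //.
have -> : signed_p'part p p = (-1)%R; last by rewrite mulrN1.
rewrite /signed_p'part logn_prime // eqxx expr1.
by rewrite part_p'nat ?mulr1 // pnatNK pnat_id.
Qed.

Lemma Zp2_nat_inj i j : i < p ^ 2 -> j < p ^ 2 ->
  (i%:R = j%:R :> 'Z_(p ^ 2))%R -> i = j.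
Proof.
move=> lti ltj /(congr1 val) /=.
by rewrite !val_Zp_nat // !modn_small.
Qed.

(** The sum [i + k] is positive and at most [(p^2 - p) + (p - 1) < p^2]: this
is why sending [p] to [-1] causes no collision with the classes prime to [p]. *)
Lemma Zp2_nat_neq_opp i k : 0 < k < p -> i <= p ^ 2 - p ->
  (i%:R <> - (k%:R) :> 'Z_(p ^ 2))%R.
Proof.
move=> /andP[k_gt0 ltkp] le_i /eqP; rewrite -subr_eq0 opprK -natrD => /eqP eq0.
have lt_ik : i + k < p ^ 2.
  by rewrite -(subnK le_p_p2) -addnS leq_add.
have := @Zp2_nat_inj (i + k) 0 lt_ik (ltnW p2_gt1) eq0.
by case: k k_gt0 {ltkp eq0 lt_ik} => // k _; rewrite addnS.
Qed.

Lemma interval_mulp i : i \in interval (p ^ 2 - p) -> p %| i ->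
  exists2 k, 0 < k < p & i = k * p.
Proof.
move=> /andP[i_gt0 le_i] /dvdnP[k def_i]; exists k => //; move: i_gt0 le_i.
rewrite def_i muln_gt0 expnS expn1 -[X in _ - X]mul1n -mulnBl.
rewrite leq_pmul2r ?(prime_gt0 p_prime) // => /andP[-> _] /= le_k.
by rewrite -(ltn_predK p_gt1) ltnS -subn1.
Qed.

Lemma signed_p'part_inj :
  {in interval (p ^ 2 - p) &, injective (signed_p'part p)}.
Proof.
have lt_int i : i \in interval (p ^ 2 - p) -> i < p ^ 2.
  move=> /andP[_ /leq_ltn_trans]; apply.
  by rewrite ltn_subrL prime_gt0 // ltnW.
have ndvd k : 0 < k < p -> ~~ (p %| k).
  by move=> /andP[k_gt0 ltkp]; rewrite gtnNdvd.
move=> i j ni nj.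
have [/(interval_mulp ni)[k kp ->]|ndi] := boolP (p %| i);
have [/(interval_mulp nj)[l lp ->]|ndj] := boolP (p %| j).
- rewrite !signed_p'part_mulp ?ndvd // => /oppr_inj eq_kl.
  have [/andP[_ ltk] /andP[_ ltl]] := (kp, lp).
  by congr (_ * _); apply: Zp2_nat_inj eq_kl; apply: leq_trans le_p_p2.
- rewrite signed_p'part_mulp ?ndvd // signed_p'part_coprime // => /esym.
  by move/Zp2_nat_neq_opp; case=> //; case/andP: nj.
- rewrite signed_p'part_coprime // signed_p'part_mulp ?ndvd //.
  by move/Zp2_nat_neq_opp; case=> //; case/andP: ni.
by rewrite !signed_p'part_coprime //; apply: Zp2_nat_inj; apply: lt_int.
Qed.

End PrimeSquare.

Theorem theorem4p26 (p : nat) (hp : prime p) :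
  exists c : nat -> nat, G_coloring (units_Zp (p ^ 2)) (p ^ 2 - p) c.
Proof.
pose h a : {unit 'Z_(p ^ 2)} := FinRing.unit _ (signed_p'part_unit hp a).
have K_gt0 a : a \in K (p ^ 2 - p) -> 0 < a by case/andP.
apply: (@G_coloring_of_morph _ _ _ h) => [a _|a b Ka Kb|].
- by rewrite inE.
- by apply: val_inj; rewrite /= signed_p'partM ?K_gt0.
apply: bij_interval_card => [|i _|i j ni nj /(congr1 val)]; last 2 first.
- by rewrite inE.
- exact: signed_p'part_inj.
rewrite card_units_Zp ?expn_gt0 ?prime_gt0 // totient_pfactor //=.
by rewrite expn1 -subn1 mulnBl mul1n mulnn.
Qed.
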